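(* Let $n,k,r$ be positive integers with $k\geq 2$, $3\leq r\leq 2k$ and $n\geq 2(r+2)(r+1)(r+2k)$. If $G$ is an $n$-vertex graph with $$e(G)\geq \left\lfloor\frac{(n-r+1)^2}{4}\right\rfloor+\binom{r}{2},$$ then $G$ contains a cycle of length $2k+1$ or $G$ contains no odd cycle of length greater than $r$.
   Context: All graphs are finite and simple, and $e(G)$ denotes the number of edges of $G$. Containing a cycle means containing it as a (not necessarily induced) subgraph. *)

(* Defs.v *)
From mathcomp Require Import all_boot.

Set Implicit Arguments.
Unset Strict Implicit.
Unset Printing Implicit Defensive.

(* A finite simple graph is given by its adjacency relation, a symmetric and
   irreflexive [e : rel T] on the finite type of vertices [T]. *)
Definition simple_graph (T : finType) (e : rel T) : Prop :=
  symmetric e /\ irreflexive e.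

Definition edge_set (T : finType) (e : rel T) : {set {set T}} :=
  [set [set x; y] | x in T, y in T & e x y].

Definition num_edges (T : finType) (e : rel T) : nat := #|edge_set e|.

(* [ucycle e c] holds for the empty sequence and, when [e] is symmetric, for a
   single edge traversed back and forth, hence the lower bound on [l]. *)
Definition contains_cycle (T : finType) (e : rel T) (l : nat) : Prop :=
  3 <= l /\ exists c : seq T, ucycle e c /\ size c = l.

(* Main.v *)
(* Let [G] have no cycle of length 2k+1. Cutting along the neighbourhood of a vertex
   of maximum degree shows that [G] is close to a balanced complete bipartite graph.
   A pair [(A, B)] of disjoint sets maximizing 3e(A,B) - 2|A||B| is then a core: any
   two vertices of one side have at least a third of the other side as common
   neighbours, so that core vertices are joined by paths of every length up to 2k of
   the right parity. Hence no vertex has neighbours in both [A] and [B], and counting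
   edges leaves at most 7(r-1) vertices outside the core. Adding to the core the
   vertices with more than 4r neighbours in it gives an induced bipartite graph [U],
   and counting again leaves a set [S] of fewer than r vertices.

   An odd cycle longer than r meets [U] at least twice, so one of its segments is a
   path through [S] between two distinct vertices of [U] whose length has the wrong
   parity for the bipartition. Closing that path inside [U] to a cycle of length 2k+1
   is possible when the missing length is at least 4; the missing lengths 3, 2 and 1
   are excluded because an obstruction costs too many edges. In the tight cases the
   path exhausts [S], which restricts the edges between [S] and [U] enough to
   contradict the exact edge bound. *)
Require Import Defs.
From mathcomp Require Import all_boot.
From mathcomp Require Import zify.

Set Implicit Arguments.
Unset Strict Implicit.
Unset Printing Implicit Defensive.

(** * Degrees and arc counts *)

Section Graph.

Variables (T : finType) (e : rel T).
Hypotheses (sym_e : symmetric e) (irr_e : irreflexive e).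

Implicit Types (X Y Z W : {set T}) (x y u v w : T) (p c : seq T).

Definition deg x Y : nat := #|[set y in Y | e x y]|.

(** Ordered pairs are counted, so an edge inside both sets contributes 2. *)
Definition arcs X Y : nat := \sum_(x in X) deg x Y.

Lemma degE x Y : deg x Y = \sum_(y in Y) e x y.
Proof.
rewrite /deg -sum1_card big_mkcond [RHS]big_mkcond.
by apply: eq_bigr => y _; rewrite inE; case: (y \in Y); case: (e x y).
Qed.

Lemma sum_setU X Y (f : T -> nat) : [disjoint X & Y] ->
  \sum_(x in X :|: Y) f x = \sum_(x in X) f x + \sum_(x in Y) f x.
Proof. by move=> dXY; rewrite -bigU //; apply: eq_bigl => x; rewrite !inE. Qed.

Lemma deg_setU x Y Z : [disjoint Y & Z] -> deg x (Y :|: Z) = deg x Y + deg x Z.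
Proof. by move=> dYZ; rewrite !degE sum_setU. Qed.

Lemma arcs_setUl X Y Z : [disjoint X & Y] ->
  arcs (X :|: Y) Z = arcs X Z + arcs Y Z.
Proof. by move=> dXY; rewrite /arcs sum_setU. Qed.

Lemma arcsC X Y : arcs X Y = arcs Y X.
Proof.
transitivity (\sum_(x in X) \sum_(y in Y) (e x y : nat)).
  by apply: eq_bigr => x _; rewrite degE.
rewrite exchange_big; apply: eq_bigr => y _; rewrite degE.
by apply: eq_bigr => x _; rewrite sym_e.
Qed.

Lemma arcs_setUr X Y Z : [disjoint Y & Z] ->
  arcs X (Y :|: Z) = arcs X Y + arcs X Z.
Proof. by move=> dYZ; rewrite arcsC arcs_setUl // !(arcsC _ X). Qed.

Lemma arcs_setU X Y : [disjoint X & Y] ->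
  arcs (X :|: Y) (X :|: Y) = arcs X X + 2 * arcs X Y + arcs Y Y.
Proof.
move=> dXY; rewrite arcs_setUl // !arcs_setUr // (arcsC Y X); lia.
Qed.

Lemma deg_le_card x Y : deg x Y <= #|Y|.
Proof. by apply/subset_leq_card/subsetP => y; rewrite inE => /andP[]. Qed.

Lemma deg_subset x Y Z : Y \subset Z -> deg x Y <= deg x Z.
Proof.
move=> sYZ; apply/subset_leq_card/subsetP => y; rewrite !inE => /andP[yY ->].
by rewrite (subsetP sYZ).
Qed.

Lemma deg_gt0P x Y : reflect (exists2 y, y \in Y & e x y) (0 < deg x Y).
Proof.
apply: (iffP card_gt0P) => [[y]|[y yY exy]]; last by exists y; rewrite inE yY.
by rewrite inE => /andP[yY exy]; exists y.
Qed.

Lemma deg_eq0 x Y : (forall y, y \in Y -> ~~ e x y) -> deg x Y = 0.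
Proof.
move=> Yx; apply/eqP; rewrite -leqn0 leqNgt; apply/negP => /deg_gt0P[y yY exy].
by move: (Yx y yY); rewrite exy.
Qed.

Lemma deg_avoid x Y (F : seq T) : size F < deg x Y ->
  exists y, [/\ y \in Y, e x y & y \notin F].
Proof.
move=> ltF; suff /subsetPn[y] : ~~ ([set y in Y | e x y] \subset [set z in F]).
  by rewrite !inE => /andP[yY exy] yF; exists y.
apply: contraL ltF => /subset_leq_card; rewrite -leqNgt => /leq_trans; apply.
by rewrite cardsE card_size.
Qed.

Lemma arcs_le X Y m : (forall x, x \in X -> deg x Y <= m) -> arcs X Y <= #|X| * m.
Proof. by move=> le_m; rewrite -sum_nat_const; apply: leq_sum. Qed.

Lemma arcs_eq0 X Y : (forall x y, x \in X -> y \in Y -> ~~ e x y) -> arcs X Y = 0.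
Proof.
move=> XY0; apply: big1 => x xX; apply: deg_eq0 => y; exact: XY0.
Qed.

Lemma deg_ltn_card x Y : x \in Y -> deg x Y < #|Y|.
Proof.
move=> xY; rewrite /deg; apply: proper_card; apply/properP.
split; first by apply/subsetP => y; rewrite inE => /andP[].
by exists x => //; rewrite inE irr_e andbF.
Qed.

Lemma arcs_self_le X : arcs X X <= #|X| * #|X|.-1.
Proof. by apply: arcs_le => x /deg_ltn_card; lia. Qed.

Lemma num_edges_arcs : 2 * num_edges e <= arcs setT setT.
Proof.
have -> : arcs setT setT = #|[set xy : T * T | e xy.1 xy.2]|.
  rewrite -sum1_card big_mkcond /= /arcs.
  under eq_bigr do rewrite degE.
  rewrite pair_big /=; apply: eq_big => [xy|xy _]; rewrite !inE //.
(* Arcs are grouped by the edge they span; each group holds both orientations. *)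
rewrite -sum1_card (partition_big (fun xy : T * T => [set xy.1; xy.2])
  (mem (edge_set e))) /=; last first.
  by move=> [x y]; rewrite inE /= => exy; apply/imset2P; exists x y; rewrite ?inE.
rewrite mulnC /num_edges -sum_nat_const; apply: leq_sum => f.
case/imset2P => x y _; rewrite !inE /= => exy ->{f}.
have neq_xy : (x, y) != (y, x).
  by apply: contraTneq exy => -[-> _]; rewrite irr_e.
have <- : #|[set (x, y); (y, x)]| = 2 by rewrite cards2 neq_xy.
rewrite sum1_card; apply/subset_leq_card/subsetP => z; rewrite !inE.
by case/orP => /eqP-> /=; rewrite unfold_in /= inE /= ?(sym_e y) exy /= // setUC.
Qed.

(** Deleting a vertex of degree at most [m] loses at most [2 * m] arcs, so the density survives
    until every degree exceeds [m]; then a path with at most [m] edges always extends at its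
    head. *)
Lemma long_path_of_arcs m W : 2 * m * #|W| < arcs W W ->
  exists x p, [/\ {subset x :: p <= W}, path e x p, uniq (x :: p) & size p = m.+1].
Proof.
have [n leWn] := ubnP #|W|; elim: n => // n IHn in W leWn *.
move=> dense_W.
have [/exists_inP[x xW le_dx]|] := boolP [exists x in W, deg x W <= m].
  have defW : W = x |: (W :\ x) by rewrite setD1K.
  have dis : [disjoint [set x] & W :\ x] by rewrite disjoints1 !inE eqxx.
  have cardW : #|W| = (#|W :\ x|).+1 by rewrite (cardsD1 x W) xW.
  have arcs1 (Y : {set T}) : arcs [set x] Y = deg x Y by rewrite /arcs big_set1.
  have [||y [p [sub_p pth_p uq_p sz_p]]] := IHn (W :\ x); first by lia.
    have le_d : deg x (W :\ x) <= m.
      by apply: leq_trans (deg_subset _ _) le_dx; apply: subD1set.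
    have d0 : deg x [set x] = 0 by apply: deg_eq0 => y /set1P->; rewrite irr_e.
    move: dense_W; rewrite {2 3}defW arcs_setU // !arcs1 d0; nia.
  exists y, p; split=> // z /sub_p; by rewrite !inE => /andP[].
rewrite negb_exists => /forallP minW.
have ltd x : x \in W -> m < deg x W.
  by move=> xW; move: (minW x); rewrite xW /= -ltnNge.
suff ext j : j <= m.+1 ->
    exists x p, [/\ {subset x :: p <= W}, path e x p, uniq (x :: p) & size p = j].
  exact: ext.
elim: j => [_|j IHj lt_jm].
  have /card_gt0P[x xW] : 0 < #|W|.
    by rewrite lt0n; apply: contraTneq dense_W => W0;
      rewrite (cards0_eq W0) /arcs big_set0.
  by exists x, [::]; split=> // y; rewrite inE => /eqP->.
have [x [p [sub_p pth_p uq_p sz_p]]] := IHj (ltnW lt_jm).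
have [|y [yW exy y_p]] := @deg_avoid x W p.
  by rewrite sz_p; apply: leq_trans (ltd x _) => //; apply: sub_p; rewrite mem_head.
exists y, (x :: p); split=> //=; last by rewrite sz_p.
- by move=> z; rewrite inE => /predU1P[->//|]; apply: sub_p.
- by rewrite sym_e exy.
- rewrite inE (negPf y_p) orbF; move: uq_p => /= ->; rewrite andbT.
  by apply: contraTneq exy => ->; rewrite irr_e.
Qed.

End Graph.

(** * An optimal bipartite pair *)

Section Core.

Variables (T : finType) (e : rel T).
Hypotheses (sym_e : symmetric e) (irr_e : irreflexive e).

Implicit Types (X Y Z W A B : {set T}) (x y u v w : T) (p c : seq T).
Local Notation deg := (deg e).
Local Notation arcs := (arcs e).

(** The constant [2 * (#|T| * #|T|)] is added to 3e(A,B) - 2|A||B| so that the subtraction never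
    truncates. *)
Definition gain A B := 3 * arcs A B + 2 * (#|T| * #|T| - #|A| * #|B|).

Definition optimal_pair A B := [disjoint A & B] /\
  forall A' B', [disjoint A' & B'] -> gain A' B' <= gain A B.

Lemma optimal_pairC A B : optimal_pair A B -> optimal_pair B A.
Proof.
have gainC X Y : gain X Y = gain Y X by rewrite /gain arcsC // [#|X| * _]mulnC.
case=> dAB opt; split=> [|A' B' dAB']; first by rewrite disjoint_sym.
by rewrite gainC [gain B A]gainC; apply: opt; rewrite disjoint_sym.
Qed.

Lemma optimal_pair_exists : exists A B, optimal_pair A B.
Proof.
pose D := [pred P : {set T} * {set T} | [disjoint P.1 & P.2]].
have D0 : D (set0, set0) by rewrite /= -setI_eq0 setI0.
case: (@arg_maxnP _ _ D (fun P => gain P.1 P.2) D0) => -[A B] /= dAB opt.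
by exists A, B; split=> // A' B'; apply: (opt (A', B')).
Qed.

Lemma arcs_set1 x Y : arcs [set x] Y = deg x Y.
Proof. by rewrite /arcs big_set1. Qed.

Lemma leq_mul_card X Y : #|X| * #|Y| <= #|T| * #|T|.
Proof. by apply: leq_mul; apply: max_card. Qed.

(** Moving [x] out of [A] changes the gain by [2 * #|B| - 3 * deg x B], which cannot be positive. *)
Lemma optimal_deg_ge A B x : optimal_pair A B -> x \in A ->
  2 * #|B| <= 3 * deg x B.
Proof.
move=> [dAB opt] xA.
have dx : [disjoint [set x] & A :\ x] by rewrite disjoints1 !inE eqxx.
have cA : #|A| = #|A :\ x|.+1 by rewrite (cardsD1 x A) xA.
have := opt (A :\ x) B (disjointWl (subD1set _ _) dAB).
have : arcs A B = deg x B + arcs (A :\ x) B.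
  by rewrite -{1}(setD1K xA) arcs_setUl // arcs_set1.
have := leq_mul_card A B; rewrite /gain => + -> ; rewrite cA; nia.
Qed.

Lemma optimal_deg_le A B x : optimal_pair A B -> x \notin A -> x \notin B ->
  3 * deg x B <= 2 * #|B|.
Proof.
move=> [dAB opt] xA xB.
have dx : [disjoint [set x] & A] by rewrite disjoints1.
have dxB : [disjoint x |: A & B].
  by rewrite -setI_eq0 setIUl setU_eq0 !setI_eq0 disjoints1 xB.
have cA : #|x |: A| = #|A|.+1 by rewrite cardsU1 xA.
have := opt _ _ dxB; have := leq_mul_card (x |: A) B.
rewrite /gain arcs_setUl // arcs_set1 cA; nia.
Qed.

(** The pair [(X, ~: X)] competes with [(A, B)], for which 3e(A,B) - 2|A||B| is at most |A||B|. *)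
Lemma optimal_cut A B X : optimal_pair A B ->
  3 * arcs X (~: X) <= 2 * (#|X| * #|~: X|) + #|A| * #|B|.
Proof.
move=> [dAB opt].
have dX : [disjoint X & ~: X] by rewrite -setI_eq0 setICr.
have lAB : arcs A B <= #|A| * #|B| by apply: arcs_le => x _; apply: deg_le_card.
have := opt _ _ dX; have := leq_mul_card A B; have := leq_mul_card X (~: X).
rewrite /gain; lia.
Qed.

(** A denser neighbourhood contains a path on [2 * k] vertices, which [x] closes to a forbidden
    cycle. *)
Lemma nbhd_arcs_le k x (X := [set y | e x y]) : 1 < k ->
  (forall c, ucycle e c -> size c <> 2 * k + 1) -> arcs X X <= 4 * (k - 1) * #|X|.
Proof.
move=> k_gt1 noC; rewrite leqNgt; apply/negP => dX.
have [|y [p [sub_p pth_p uq_p sz_p]]] :=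
  @long_path_of_arcs _ e sym_e irr_e (2 * (k - 1)) X.
  lia.
case: (noC (x :: y :: p)); last by rewrite /= sz_p; lia.
have adj z : z \in y :: p -> e x z by move/sub_p; rewrite inE.
rewrite /ucycle cons_uniq uq_p andbT /cycle rcons_path /= [path _ _ _]pth_p.
rewrite adj ?mem_head //= sym_e adj ?mem_last //=.
by apply/negP => /adj; rewrite irr_e.
Qed.

(* Füredi's stability argument: cut along the neighbourhood [X] of a vertex of
   maximum degree, so that the degrees outside [X] are at most [#|X|]. *)
Lemma max_degree_cut k : 1 < k -> 0 < #|T| ->
  (forall c, ucycle e c -> size c <> 2 * k + 1) ->
  exists X, arcs setT setT <=
    4 * (k - 1) * #|X| + arcs X (~: X) + #|X| * #|~: X|.
Proof.
move=> k_gt1 /card_gt0P[x1 _] noC.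
case: (@arg_maxnP _ x1 xpredT (fun x => deg x setT)) => // x _ max_x.
pose X := [set y | e x y]; exists X.
have dX : [disjoint X & ~: X] by rewrite -setI_eq0 setICr.
have degX : deg x setT = #|X| by apply: eq_card => y; rewrite !inE.
have : arcs (~: X) setT <= #|~: X| * #|X|.
  by apply: arcs_le => y _; rewrite -degX; apply: max_x.
have := nbhd_arcs_le x k_gt1 noC.
rewrite -/X -(setUCr X) arcs_setUr // arcs_setU // (arcsC sym_e (~: X) X); lia.
Qed.

End Core.

(** * Paths in the core *)

Section CorePaths.

Variables (T : finType) (e : rel T).
Hypotheses (sym_e : symmetric e) (irr_e : irreflexive e).

Implicit Types (X Y Z W A B : {set T}) (x y u v w : T) (p c F : seq T) (b : bool).
Local Notation deg := (deg e).
Local Notation arcs := (arcs e).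

(** Indexing the sides by booleans makes [b (+) odd L] the side reached from [b] after [L] steps. *)
Variables (C : bool -> {set T}) (m : nat).
Hypothesis linked : forall b x y, x \in C b -> y \in C b ->
  m <= #|[set z in C (~~ b) | e x z && e y z]|.

Hypothesis disjC : forall b x, x \in C b -> x \notin C (~~ b).

Let core := C true :|: C false.

Lemma mem_core b x : x \in C b -> x \in core.
Proof. by rewrite inE; case: b => ->; rewrite ?orbT. Qed.

Lemma linked_deg b x : x \in C b -> m <= deg x (C (~~ b)).
Proof.
move=> xC; apply: leq_trans (linked xC xC) _; apply/subset_leq_card/subsetP => z.
by rewrite !inE andbb.
Qed.

(** Walk greedily to fresh vertices, then bridge the last two steps by a common neighbour. Each step
    moves one vertex into the forbidden list [F] and lowers [L] by one, so [size F + L] is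
    constant. *)
Lemma core_path L b x y F : x \in C b -> y \in C (b (+) odd L) -> x != y ->
  1 < L -> size F + L <= m ->
  exists p, [/\ path e x (rcons p y), uniq (x :: rcons p y),
    {subset p <= core}, {in p, forall z, z \notin F} & size p = L.-1].
Proof.
elim: L b x F => // -[//|[_|L IHL]] b x F xC yC neq_xy _ szF.
  rewrite addbF in yC.
  have ltF : size F < #|[set z in C (~~ b) | e x z && e y z]|.
    by apply: leq_trans (linked xC yC); lia.
  have /subsetPn[z] : ~~ ([set z in C (~~ b) | e x z && e y z] \subset [set z in F]).
    apply: contraL ltF => /subset_leq_card; rewrite -leqNgt => /leq_trans; apply.
    by rewrite cardsE card_size.
  rewrite !inE => /and3P[zC exz eyz] zF; exists [:: z]; split=> //=.
  - by rewrite exz sym_e eyz.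
  - rewrite !inE negb_or neq_xy !andbT; apply/andP; split.
      by apply: contraTneq exz => ->; rewrite irr_e.
    by apply: contraTneq eyz => ->; rewrite irr_e.
  - by move=> t; rewrite inE => /eqP->; apply: mem_core zC.
  - by move=> t; rewrite inE => /eqP->.
have [|x1 [x1C exx1 x1F]] := @deg_avoid _ e x (C (~~ b)) (y :: F).
  by apply: leq_trans (linked_deg xC) => /=; lia.
move: x1F; rewrite inE negb_or => /andP[neq_x1y x1F].
have [|||p [pth_p uq_p sub_p avd_p sz_p]] := IHL (~~ b) x1 (x :: F) x1C _ _ isT.
- by move: yC => /=; rewrite !negbK addbN addNb.
- by [].
- by rewrite /=; lia.
exists (x1 :: p); split=> //=.
- by rewrite exx1.
- rewrite -/(uniq (x1 :: rcons p y)) uq_p andbT inE negb_or mem_rcons inE negb_or.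
  rewrite neq_xy /=; apply/andP; split.
    by apply: contraTneq exx1 => <-; rewrite irr_e.
  by apply/negP => /avd_p; rewrite mem_head.
- by move=> t; rewrite inE => /predU1P[->|/sub_p//]; apply: mem_core x1C.
- move=> t; rewrite inE => /predU1P[->//|/avd_p].
  by rewrite inE negb_or => /andP[].
- by rewrite sz_p.
Qed.

Variable k : nat.
Hypotheses (k_gt1 : 1 < k) (le2k_m : 2 * k <= m).
Hypothesis noC : forall c, ucycle e c -> size c <> 2 * k + 1.

(** A core path of odd length [2 * k - 1] from [x] to [y] avoiding [w] would close through [w]. *)
Lemma no_nbr_both b w x y : x \in C b -> y \in C (~~ b) -> e w x -> ~~ e w y.
Proof.
move=> xC yC ewx; apply/negP => ewy.
have [|||||p [pth_p uq_p _ avd_p sz_p]] := @core_path (2 * k - 1) b x y [:: w] => //.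
- by rewrite oddB ?oddM ?addbT //; lia.
- by apply: contraTneq yC => <-; apply: (disjC xC).
- by lia.
- by rewrite /=; lia.
apply: (noC (c := w :: x :: rcons p y)); last by rewrite /= size_rcons sz_p; lia.
rewrite /ucycle cons_uniq uq_p andbT /cycle rcons_path /= ewx pth_p last_rcons.
rewrite sym_e ewy /=.
rewrite inE mem_rcons inE !negb_or; apply/and3P; split.
- by apply: contraTneq ewx => ->; rewrite irr_e.
- by apply: contraTneq ewy => ->; rewrite irr_e.
- by apply/negP => /avd_p; rewrite mem_head.
Qed.

Variable tau : nat.
Hypotheses (tau_gt2 : 2 < tau) (le_tau_m : tau <= m).

(** The threshold [tau] is left free: the value 3 gives independence of the core sides, the value
    [4 * r + 1] the bipartite graph [U]. *)
Definition hull b := [set w | tau <= deg w (C (~~ b))].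

Lemma mem_hull b x : x \in C b -> x \in hull b.
Proof. by move=> xC; rewrite inE (leq_trans le_tau_m) // linked_deg. Qed.

Lemma core_sub_hull : core \subset hull true :|: hull false.
Proof.
by apply: setUSS; apply/subsetP => x; apply: mem_hull.
Qed.

Lemma deg_core_side x : exists b, deg x (C (~~ b)) = 0 /\ deg x core = deg x (C b).
Proof.
have dC : [disjoint C true & C false].
  by apply/pred0P => y /=; apply/negP => /andP[/disjC/negP].
rewrite deg_setU //.
have [/deg_gt0P[y yC exy]|] := boolP (0 < deg x (C true)).
  exists true; rewrite deg_eq0 ?addn0 // => z zC; exact: (no_nbr_both yC zC exy).
by rewrite -eqn0Ngt => /eqP d0; exists false; rewrite /= d0.
Qed.

Lemma hull_disjoint b x : x \in hull b -> x \notin hull (~~ b).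
Proof.
rewrite !inE negbK -ltnNge => ltb; case: (deg_core_side x) => b' [].
by case: b b' ltb => -[] /= ltb d0 _; rewrite ?d0; lia.
Qed.

Lemma deg_core_outside x : x \notin hull true -> x \notin hull false ->
  deg x core < tau.
Proof. by rewrite !inE -!ltnNge; case: (deg_core_side x) => -[] [_ ->]. Qed.

(** One step from each end enters the core, and a core path of length [L - 2] joins the two entry
    points. The second entry point must avoid two vertices, hence [2 < tau]. *)
Lemma hull_path L b u v : u \in hull b -> v \in hull (b (+) odd L) -> u != v ->
  3 < L <= 2 * k ->
  exists p, [/\ path e u (rcons p v), uniq (u :: rcons p v),
    {subset p <= core} & size p = L.-1].
Proof.
rewrite !inE => ub vb neq_uv /andP[L_gt3 L_le].
have [|x [xC eux]] := @deg_avoid _ e u (C (~~ b)) [:: v]; first by rewrite /=; lia.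
rewrite inE => neq_xv.
have [|y [yC evy]] := @deg_avoid _ e v (C (~~ (b (+) odd L))) [:: u; x].
  by rewrite /=; lia.
rewrite !inE negb_or => /andP[neq_yu neq_yx].
have [||||p [pth_p uq_p sub_p avd_p sz_p]] := @core_path (L - 2) (~~ b) x y [:: u; v] xC.
- by rewrite oddB ?addbF; [rewrite addNb | lia].
- by rewrite eq_sym.
- by lia.
- by rewrite /=; lia.
exists (x :: rcons p y); split.
- by rewrite /= eux rcons_path pth_p last_rcons sym_e evy.
- have neq_ux : u != x by apply: contraTneq eux => ->; rewrite irr_e.
  have neq_vy : v != y by apply: contraTneq evy => ->; rewrite irr_e.
  have u_p : u \notin p by apply/negP => /avd_p; rewrite mem_head.
  have v_p : v \notin p by apply/negP => /avd_p; rewrite !inE eqxx orbT.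
  rewrite cons_uniq rcons_uniq uq_p andbT !(mem_rcons, inE) !negb_or neq_uv neq_ux.
  by rewrite eq_sym neq_yu u_p eq_sym neq_xv neq_vy v_p.
- move=> z; rewrite inE mem_rcons inE => /or3P[/eqP->|/eqP->|/sub_p//].
    exact: mem_core xC.
  exact: mem_core yC.
- by rewrite /= size_rcons sz_p; lia.
Qed.

Lemma hull_indep b u v : u \in hull b -> v \in hull b -> ~~ e u v.
Proof.
move=> ub vb; apply/negP => euv.
have neq_uv : u != v by apply: contraTneq euv => ->; rewrite irr_e.
have [||p [pth_p uq_p _ sz_p]] := @hull_path (2 * k) b u v ub _ neq_uv.
- by rewrite oddM addbF.
- by lia.
apply: (noC (c := u :: rcons p v)); last by rewrite /= size_rcons sz_p; lia.
by rewrite /ucycle uq_p andbT /cycle rcons_path pth_p last_rcons sym_e euv.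
Qed.

End CorePaths.

(** * Size of the core *)

Lemma double_mul_le_sqr a b : 2 * (a * b) <= a * a + b * b.
Proof. by rewrite !mulnn nat_Cauchy. Qed.

(** The factor 40 is 2 * 5 * 4, the value at [r = 3]; the second bound uses [r + 2 * k >= 2 * r] and
    [r^3 >= 3 * r^2]. *)
Lemma large_order_bounds n k r : 2 < r -> r <= 2 * k ->
  2 * (r + 2) * (r + 1) * (r + 2 * k) <= n ->
  40 * (r + 2 * k) <= n /\ 24 * (r * r) + 8 * r <= n.
Proof.
move=> r_gt2 le_r n_large; split.
  apply: leq_trans n_large; rewrite leq_mul2r; apply/orP; right; nia.
apply: leq_trans n_large.
have : (r + 2) * (r + 1) * (r + r) <= (r + 2) * (r + 1) * (r + 2 * k).
  by rewrite leq_mul2l; apply/orP; right; lia.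
have : r * (r * 3) <= r * (r * r) by rewrite !leq_mul2l r_gt2 !orbT.
lia.
Qed.

Lemma arcs_lower_bound n r N : 2 < r -> r <= n ->
  2 * ((n - r + 1) ^ 2 %/ 4) + r * (r - 1) <= N ->
  n ^ 2 <= 2 * N + 2 * (n * (r - 1)).
Proof.
move=> r_gt2 le_rn; have := divn_eq ((n - r + 1) ^ 2) 4.
have := ltn_pmod ((n - r + 1) ^ 2) (isT : 0 < 4).
move: (_ %/ 4) (_ %% 4) => F f ltf.
have [M defn] : exists M, n = M + r by exists (n - r); lia.
subst n; have -> : M + r - r + 1 = M + 1 by lia.
have [s ->] : exists s, r = s + 3 by exists (r - 3); lia.
have -> : s + 3 - 1 = s + 2 by lia.
rewrite -!mulnn; nia.
Qed.

(** Here [3 * N] is nearly 3/2 n^2 at least and [5 * (x * y)] is 5/4 n^2 at most, so [P] is nearly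
    n^2/4; under [40 * (r + 2 * k) <= n] the errors leave the fraction 173/1000. *)
Lemma core_product_bound n k r N x y P : 1 < k -> 40 * (r + 2 * k) <= n ->
  0 < r -> n ^ 2 <= 2 * N + 2 * (n * (r - 1)) -> x + y = n ->
  3 * N <= 12 * (k - 1) * x + 5 * (x * y) + P ->
  173 * n ^ 2 <= 1000 * P.
Proof.
move=> k_gt1 n_large r_gt0 lowN defn leN.
have [K defk] : exists K, k = K + 1 by exists (k - 1); lia.
have [s defr] : exists s, r = s + 1 by exists (r - 1); lia.
subst k r n; rewrite !addnK in lowN leN; rewrite -!mulnn in lowN *.
have := leq_mul (leqnn (x + y)) n_large.
have h2 : 80 * K <= x + y by lia.
have := leq_mul h2 h2.
(* Completing the square: 12Kx + 5x(n - x) is at most (5n + 12K)^2 / 20. *)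
have := double_mul_le_sqr (10 * x) (5 * (x + y) + 12 * K).
lia.
Qed.

(** A side below n/5 would give a product below 0.16 n^2. *)
Lemma side_bound n a b : 0 < n -> a + b <= n -> 173 * n ^ 2 <= 1000 * (a * b) ->
  n <= 5 * b.
Proof.
move=> n_gt0 le_ab hP; rewrite leqNgt; apply/negP => lt_b.
have [c defn] : exists c, n = 5 * b + c + 1 by exists (n - 5 * b - 1); lia.
have le_a : a <= 4 * b + c + 1 by lia.
have := leq_mul le_a (leqnn b); subst n; rewrite -!mulnn in hP *; lia.
Qed.

(** The product bound alone forces [23 * q <= 4 * n]. This absorbs the term quadratic in [q] of the
    edge count and leaves [124 * q <= 828 * (r - 1)], hence the factor 7. *)
Lemma outside_bound n r N a b q : 0 < r -> a + b + q = n -> 0 < n ->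
  n ^ 2 <= 2 * N + 2 * (n * (r - 1)) -> 173 * n ^ 2 <= 1000 * (a * b) ->
  3 * N <= 6 * (a * b) + 4 * (q * a) + 3 * (q * q) ->
  q <= 7 * (r - 1).
Proof.
move=> r_gt0 defn n_gt0 lowN hP leN.
have [s defr] : exists s, r = s + 1 by exists (r - 1); lia.
subst r; rewrite !addnK in lowN *; rewrite -!mulnn in lowN hP.
have h1 : 23 * q <= 4 * n.
  rewrite leqNgt; apply/negP => lt_q.
  have lt1 : 4 * (a + b) + 1 <= 19 * q by lia.
  have := leq_mul lt1 lt1; have := leq_mul (leqnn (a + b)) lt1.
  have := double_mul_le_sqr a b; subst n; lia.
have h2 : 12 * (n * q) <= 36 * (n * s) + 38 * (q * q).
  have := double_mul_le_sqr (6 * a) (3 * a + 3 * b + 2 * q).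
  subst n; lia.
have h3 := leq_mul h1 (leqnn q).
have h4 : n * q * 124 <= n * s * 828 by lia.
have : n * (q * 124) <= n * (s * 828) by rewrite !mulnA.
rewrite leq_pmul2l //; lia.
Qed.

Section CoreExists.

Variables (T : finType) (e : rel T).
Hypotheses (sym_e : symmetric e) (irr_e : irreflexive e).
Local Notation deg := (deg e).
Local Notation arcs := (arcs e).

Lemma core_exists (n k r : nat) : #|T| = n -> 1 < k -> 2 < r -> r <= 2 * k ->
  2 * (r + 2) * (r + 1) * (r + 2 * k) <= n ->
  (forall c, ucycle e c -> size c <> 2 * k + 1) ->
  2 * ((n - r + 1) ^ 2 %/ 4) + r * (r - 1) <= arcs setT setT ->
  exists (C : bool -> {set T}) (m : nat),
    [/\ forall b x y, x \in C b -> y \in C b ->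
          m <= #|[set z in C (~~ b) | e x z && e y z]|,
        forall b x, x \in C b -> x \notin C (~~ b),
        2 * k <= m, 4 * r + 1 <= m &
        n <= #|C true :|: C false| + 7 * (r - 1)].
Proof.
move=> cardT k_gt1 r_gt2 le_r n_large noC le_arcs.
have [n_large1 _] := large_order_bounds r_gt2 le_r n_large.
have low : n ^ 2 <= 2 * arcs setT setT + 2 * (n * (r - 1)).
  by apply: arcs_lower_bound le_arcs; lia.
have [A [B opt]] := optimal_pair_exists e.
have optC := optimal_pairC sym_e opt.
have [|X leX] := max_degree_cut sym_e irr_e k_gt1 _ noC; first by lia.
have cutX := optimal_cut X opt.
have prodAB : 173 * n ^ 2 <= 1000 * (#|A| * #|B|).
  apply: (core_product_bound k_gt1 n_large1 _ low (_ : #|X| + #|~: X| = n)); first by lia.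
    by rewrite cardsC.
  lia.
have dAB : [disjoint A & B] by case: opt.
have cardAB : #|A :|: B| = #|A| + #|B|.
  by rewrite cardsU (_ : A :&: B = set0) ?cards0 ?subn0 //; apply/eqP; rewrite setI_eq0.
have leAB : #|A| + #|B| <= n by rewrite -cardAB -cardT max_card.
have n_gt0 : 0 < n by lia.
have le_B := side_bound n_gt0 leAB prodAB.
have le_A : n <= 5 * #|A|.
  by apply: (@side_bound n #|B|); rewrite // 1?addnC 1?[#|B| * _]mulnC.
pose C b := if b then A else B.
have optC' b : optimal_pair e (C b) (C (~~ b)) by case: b.
(* Two neighbourhoods, each covering two thirds of a side, overlap in at least a third of it. *)
pose m := minn #|A| #|B| %/ 3.
have le_m b : 3 * m <= #|C b|.
  rewrite /m mulnC; apply: leq_trans (leq_trunc_div _ _) _.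
  by case: b; rewrite geq_min leqnn ?orbT.
have linked b x y : x \in C b -> y \in C b ->
    m <= #|[set z in C (~~ b) | e x z && e y z]|.
  move=> xC yC; have dx := optimal_deg_ge (optC' b) xC.
  have dy := optimal_deg_ge (optC' b) yC; have := le_m (~~ b).
  set N := [set z in _ | _].
  have -> : N = [set z in C (~~ b) | e x z] :&: [set z in C (~~ b) | e y z].
    by apply/setP => z; rewrite !inE; case: (z \in C (~~ b)).
  have := cardsUI [set z in C (~~ b) | e x z] [set z in C (~~ b) | e y z].
  have : #|[set z in C (~~ b) | e x z] :|: [set z in C (~~ b) | e y z]| <= #|C (~~ b)|.
    by apply/subset_leq_card/subsetP => z; rewrite !inE => /orP[] /andP[].
  by rewrite /deg in dx dy; lia.
have disjC b x : x \in C b -> x \notin C (~~ b).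
  move=> xC; have [dC _] := optC' b.
  by apply/negP => xC'; move/pred0P: dC => /(_ x) /=; rewrite xC xC'.
have le2k_m : 2 * k <= m by rewrite /m; lia.
have le4r_m : 4 * r + 1 <= m by rewrite /m; lia.
exists C, m; split=> //=; rewrite cardAB.
have C_indep b x y : x \in C b -> y \in C b -> ~~ e x y.
  move=> xC yC; have le3_m : 3 <= m by lia.
  by apply: (hull_indep sym_e irr_e linked k_gt1 le2k_m noC (leqnn 3) le3_m (b := b));
    apply: (mem_hull linked).
pose Q := ~: (A :|: B).
have cardQ : #|A| + #|B| + #|Q| = n by rewrite -cardAB cardsC.
(* A vertex outside the core sees only one side and, by optimality, at most two thirds of it; [maxn]
   covers not knowing which side. *)
have degQ x : x \in Q -> 3 * deg x (A :|: B) <= 2 * maxn #|A| #|B|.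
  rewrite !inE negb_or => /andP[xA xB].
  have [b [_ degx]] := deg_core_side sym_e irr_e linked disjC k_gt1 le2k_m noC x.
  rewrite -[A :|: B]/(C true :|: C false) degx.
  apply: leq_trans (_ : 2 * #|C b| <= _); last first.
    by rewrite leq_mul2l /=; case: (b); rewrite leq_max leqnn ?orbT.
  apply: (optimal_deg_le (A := C (~~ b))); last by case: (b).
    by rewrite -{2}[b]negbK; apply: optC'.
  by case: (b).
have arcsQ : 3 * arcs Q (A :|: B) <= 2 * (#|Q| * maxn #|A| #|B|).
  rewrite mulnCA -sum_nat_const /arcs big_distrr /=; exact: leq_sum.
have arcsT : arcs setT setT <= 2 * (#|A| * #|B|) + 2 * arcs Q (A :|: B) + #|Q| * #|Q|.
  have dQ : [disjoint A :|: B & Q] by rewrite -setI_eq0 setICr.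
  rewrite -(setUCr (A :|: B)) -/Q arcs_setU // arcs_setU // (arcsC sym_e _ Q).
  have := arcs_self_le irr_e Q; have : #|Q| * #|Q|.-1 <= #|Q| * #|Q|.
    by rewrite leq_mul2l leq_pred orbT.
  have := @arcs_le _ e A B #|B| (fun x _ => deg_le_card e x B).
  rewrite (arcs_eq0 (C_indep true)) (arcs_eq0 (C_indep false)); lia.
rewrite -cardQ leq_add2l; case: (leqP #|A| #|B|) => [leqAB|/ltnW leqAB].
  rewrite (maxn_idPr leqAB) in arcsQ.
  apply: (outside_bound (a := #|B|) (b := #|A|) _ _ n_gt0 low); try lia.
rewrite (maxn_idPl leqAB) in arcsQ.
by apply: (outside_bound (a := #|A|) (b := #|B|) _ _ n_gt0 low); lia.
Qed.

End CoreExists.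

(** * Arithmetic of the edge counts outside the core *)

Lemma quarter_sqr_bounds M : M * M <= 4 * (M ^ 2 %/ 4) + 3.
Proof.
rewrite mulnn {1}(divn_eq (M ^ 2) 4) [4 * _]mulnC leq_add2l.
by rewrite -ltnS ltn_pmod.
Qed.

Lemma mul_le_quarter_sqr a b : a * b <= (a + b) ^ 2 %/ 4.
Proof. by rewrite leq_divRL // mulnC nat_AGM2. Qed.

(** With [s = r + j], the square of [n - r + 1] exceeds that of [n - s] by at least
    [2 * (1 + j) * (n - s)], while the terms in [s] are at most [44 * (1 + j) * r^2]. *)
Lemma small_rest_arith n r s F : 2 < r -> 24 * (r * r) + 8 * r <= n ->
  (n - r + 1) * (n - r + 1) <= 4 * F + 3 -> r <= s -> s <= 7 * (r - 1) ->
  4 * F + 2 * (r * (r - 1)) <=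
    (n - s) * (n - s) + 4 * (s * (11 * r - 7 - s)) + 2 * (s * s) ->
  False.
Proof.
move=> r_gt2 n_large leF le_rs le_s budget.
have [j defs] : exists j, s = r + j by exists (s - r); lia.
have [M defn] : exists M, n = M + s by exists (n - s); lia.
have hM : 44 * (r * r) + 10 <= 2 * M by lia.
subst n s; have eM : M + (r + j) - r + 1 = M + 1 + j by lia.
rewrite eM addnK in leF budget.
have [i defi] : exists i, 11 * r - 7 - (r + j) = i by exists (11 * r - 7 - (r + j)).
rewrite defi in budget.
have hj : r + j <= (1 + j) * r.
  by rewrite mulnDl mul1n leq_add2l leq_pmulr //; lia.
have hi : 4 * i + 2 * (r + j) <= 44 * r by lia.
have := leq_mul hj hi.
have := leq_mul (leqnn (1 + j)) hM.
have : 0 <= r * (r - 1) by [].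
lia.
Qed.

Lemma link3_arith n r s F a b E : 2 < r -> 24 * (r * r) + 8 * r <= n ->
  (n - r + 1) * (n - r + 1) <= 4 * F + 3 -> r <= s + 3 -> s < r -> a + b + s = n ->
  E + a + b + (4 * r - 1) * (4 * r - 1) <= a * b + 3 ->
  2 * F + r * (r - 1) <= 2 * E + 2 * (s * (11 * r - 7 - s)) + s * s -> False.
Proof.
move=> r_gt2 n_large leF le_rs lt_sr defn leE budget.
have sq := double_mul_le_sqr a b.
have [N defN] : exists N, a + b = N + 2 by exists (a + b - 2); lia.
have leM : N <= n - r + 1 by lia.
have := leq_mul leM leM.
have : s * (11 * r - 7 - s) <= r * (11 * r) by apply: leq_mul; lia.
have : s * s <= r * r by apply: leq_mul; lia.
have : (a + b) * (a + b) = (N + 2) * (N + 2) by rewrite defN.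
have [t defr] : exists t, r = t + 3 by exists (r - 3); lia.
have : (4 * r - 1) * (4 * r - 1) = (4 * t + 11) * (4 * t + 11) by congr (_ * _); lia.
move: budget leE; set A := (4 * r - 1) * _; set B := s * (_ - _); set D := s * s.
set G := (n - r + 1) * _ in leF *; set Q := r * (r - 1).
rewrite {n_large leM}; subst r; lia.
Qed.

(** [a * b - b] is a product of two numbers with sum [n - r], so about n/2 edges are lost however
    unbalanced the sides are. *)
Lemma link2_arith n r s F a b E : 2 < r -> 24 * (r * r) + 8 * r <= n ->
  (n - r + 1) * (n - r + 1) <= 4 * F + 3 -> s.+1 = r -> a + b + s = n ->
  E + b <= a * b ->
  2 * F + r * (r - 1) <= 2 * E + 2 * (s * (11 * r - 7 - s)) + s * s -> False.
Proof.
move=> r_gt2 n_large leF defr defn leE budget.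
have M_gt0 : 24 * (r * r) + 7 * r < a + b by lia.
have eM : n - r + 1 = a + b by lia.
have : s * (11 * r - 7 - s) <= r * (11 * r) by apply: leq_mul; lia.
have : s * s <= r * r by apply: leq_mul; lia.
rewrite eM in leF; case: a eM defn leE M_gt0 leF => [|a] eM defn leE M_gt0 leF.
  lia.
have := double_mul_le_sqr a b.
move: budget; set B := s * (_ - _); set D := s * s; set Q := r * (r - 1).
lia.
Qed.

(** * Paths of the wrong parity *)

(** The missing pairs number at least [x * y] between the two neighbourhoods, [b - y - 1] at one
    endpoint and one for each of the [z] other vertices: in all [a + b - 3 + (x - 1) * (y - 1)]. *)
Lemma missing_arith r a b c x y z du ax az : a = c.+1 -> z + x = c ->
  y < b -> 4 * r - 1 < x -> 4 * r - 1 < y ->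
  du <= y.+1 -> ax <= x * (b - y) -> az <= z * b.-1 ->
  du + ax + az + a + b + (4 * r - 1) * (4 * r - 1) <= a * b + 3.
Proof.
move: (4 * r - 1) => m -> <- lt_yb lt_x lt_y.
have [j yE] : exists j, y = m + 1 + j by exists (y - (m + 1)); lia.
have [i xE] : exists i, x = m + 1 + i by exists (x - (m + 1)); lia.
have [t bE] : exists t, b = y + t + 1 by exists (b - y.+1); lia.
have [-> ->] : b - y = t + 1 /\ b.-1 = y + t by lia.
subst b x y; lia.
Qed.

(** The contradiction is by a single edge: [(s + 2) * (s + 1)] is [s * (s - 1) + 4 * s + 2]. *)
Lemma even_arith r s F a b x : 0 < s -> r = s + 2 -> (a + 1) * b <= F ->
  2 * F + r * (r - 1) <= 2 * x + s * s.-1 -> x <= b + 2 * s + a * b -> False.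
Proof.
move=> s_gt0 ->; have [t ->] : exists t, s = t + 1 by exists (s - 1); lia.
have -> : t + 1 + 2 - 1 = t + 2 by lia.
have -> : (t + 1).-1 = t by lia.
lia.
Qed.

(** Again one edge decides: the bound on [x] is [a * b + s - 1], and [(s + 1) * s] is
    [s * (s - 1) + 2 * s]. *)
Lemma odd_arith r s F a b a' b' x : 0 < s -> r = s + 1 -> a = 1 + a' -> b = 1 + b' ->
  a * b <= F -> 2 * F + r * (r - 1) <= 2 * x + s * s.-1 ->
  x <= a' * b + b' + s -> False.
Proof.
move=> s_gt0 -> -> ->; have [t ->] : exists t, s = t + 1 by exists (s - 1); lia.
have -> : t + 1 + 1 - 1 = t + 1 by lia.
have -> : (t + 1).-1 = t by lia.
lia.
Qed.

Section WrongPaths.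

Variables (T : finType) (e : rel T).
Hypotheses (sym_e : symmetric e) (irr_e : irreflexive e).

Implicit Types (X Y : {set T}) (x y z u v w : T) (p q c : seq T) (b : bool).
Local Notation deg := (deg e).
Local Notation arcs := (arcs e).

(** [F] stands for the floor of (n - r + 1)^2 / 4 and enters only through the two inequalities
    assumed below. *)
Variables (R : bool -> {set T}) (k r n F : nat).
Let U := R true :|: R false.
Let S := ~: U.

Hypotheses (k_gt1 : 1 < k) (r_gt2 : 2 < r) (r_le2k : r <= 2 * k).
Hypothesis cardT : #|T| = n.
Hypothesis n_large : 24 * (r * r) + 8 * r <= n.
Hypothesis sqr_le_F : (n - r + 1) * (n - r + 1) <= 4 * F + 3.
Hypothesis mul_le_F : forall i j : nat, i + j = n - r + 1 -> i * j <= F.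
Hypothesis noC : forall c, ucycle e c -> size c <> 2 * k + 1.
Hypothesis disjR : forall b x, x \in R b -> x \notin R (~~ b).
Hypothesis indepR : forall b u v, u \in R b -> v \in R b -> ~~ e u v.
Hypothesis pathR : forall L b u v, u \in R b -> v \in R (b (+) odd L) -> u != v ->
  3 < L <= 2 * k ->
  exists p, [/\ path e u (rcons p v), uniq (u :: rcons p v),
    {subset p <= U} & size p = L.-1].
Hypothesis degR : forall b u, u \in R b -> 4 * r < deg u (R (~~ b)).
(** At most [4 * r] neighbours lie in the core, and at most [7 * (r - 1) - #|S|] vertices of [U] lie
    outside it. *)
Hypothesis degS : forall x, x \in S -> deg x U <= 11 * r - 7 - #|S|.
Hypothesis leS : #|S| <= 7 * (r - 1).
Hypothesis many_arcs : 2 * F + r * (r - 1) <= arcs setT setT.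

Local Ltac qlia :=
  clear n_large sqr_le_F mul_le_F many_arcs leS degS degR; lia.

Lemma mem_U b x : x \in R b -> x \in U.
Proof. by rewrite inE; case: b => ->; rewrite ?orbT. Qed.

Let chi x := x \in R true.

Lemma mem_side x : x \in U -> x \in R (chi x).
Proof. by rewrite inE /chi; case xR: (x \in R true). Qed.

Lemma chiE b x : x \in R b -> chi x = b.
Proof. by rewrite /chi; case: b => [-> //|/disjR/negPf /= ->]. Qed.

Lemma U_setE b : U = R b :|: R (~~ b).
Proof. by case: b => //; rewrite setUC. Qed.

Lemma disjoint_sides b : [disjoint R b & R (~~ b)].
Proof. by apply/pred0P => y /=; apply/negP => /andP[/disjR/negP]. Qed.

Lemma disjoint_US : [disjoint U & S].
Proof. by rewrite -setI_eq0 setICr. Qed.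

Lemma card_sides b : #|R b| + #|R (~~ b)| + #|S| = n.
Proof.
rewrite -cardT -(cardsC U) -/S (U_setE b) cardsU (_ : _ :&: _ = set0) ?cards0 ?subn0 //.
by apply/eqP; rewrite setI_eq0 disjoint_sides.
Qed.

Lemma budget b :
  2 * F + r * (r - 1) <= 2 * (arcs (R b) (R (~~ b)) + arcs U S) + #|S| * #|S|.-1.
Proof.
apply: leq_trans many_arcs _.
rewrite -(setUCr U) -/S arcs_setU ?disjoint_US // {1 2}(U_setE b).
rewrite (arcs_setU sym_e (disjoint_sides b)) (arcs_eq0 (@indepR b)).
rewrite (arcs_eq0 (@indepR (~~ b))); have := arcs_self_le irr_e S; lia.
Qed.

Lemma crude_budget b :
  2 * F + r * (r - 1) <=
  2 * arcs (R b) (R (~~ b)) + 2 * (#|S| * (11 * r - 7 - #|S|)) + #|S| * #|S|.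
Proof.
have := budget b; have := arcs_le degS; rewrite (arcsC sym_e).
have : #|S| * #|S|.-1 <= #|S| * #|S| by rewrite leq_mul2l leq_pred orbT.
lia.
Qed.

Lemma le_arcs_sides b : arcs (R b) (R (~~ b)) <= #|R b| * #|R (~~ b)|.
Proof. by apply: arcs_le => x _; apply: deg_le_card. Qed.

Lemma card_S_lt : #|S| < r.
Proof.
rewrite ltnNge; apply/negP => le_r.
have /= cardE := card_sides true.
have /= h3 := crude_budget true; have /= h2 := le_arcs_sides true.
have h1 := double_mul_le_sqr #|R true| #|R false|.
 apply: (small_rest_arith r_gt2 n_large sqr_le_F le_r leS).
have -> : n - #|S| = #|R true| + #|R false| by lia.
move: h3; move: (11 * r - 7 - #|S|) (r * (r - 1)) => A B h3.
lia.
Qed.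

(** * Links of length 3 and 2 between vertices of [U] *)

Lemma deg_setD1 x y Y : y \in Y -> deg x Y = e x y + deg x (Y :\ y).
Proof. by move=> yY; rewrite !degE (big_setD1 y). Qed.

(** Otherwise no edge joins the neighbours [X] of [v] to the neighbours [Y] of [u], two sets of at
    least [4 * r] vertices, and too many pairs are missing. *)
Lemma link3 b u v : r <= #|S| + 3 -> u \in R b -> v \in R (~~ b) ->
  exists x y, [/\ x \in R b, y \in R (~~ b), u != x & v != y] /\
    [/\ e u y, e y x & e x v].
Proof.
move=> le_r ub vb.
pose Y := [set y in R (~~ b) :\ v | e u y]; pose X := [set x in R b :\ u | e v x].
have [/exists_inP[x xX /exists_inP[y yY eyx]]|] :=
    boolP [exists x in X, [exists y in Y, e y x]].
  move: xX yY; rewrite !inE => /andP[/andP[xu xb] evx] /andP[/andP[yv yb] euy].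
  by exists x, y; rewrite (sym_e x) !(eq_sym u, eq_sym v).
move=> noXY; exfalso.
have XY0 x y : x \in X -> y \in Y -> ~~ e x y.
  move=> xX yY; apply: contra noXY => exy; apply/exists_inP; exists x => //.
  by apply/exists_inP; exists y; rewrite // sym_e.
have cardY : 4 * r <= #|Y|.
  have := degR ub; rewrite (deg_setD1 u vb) /deg -/Y; case: (e u v) => /=; lia.
have cardX : 4 * r <= #|X|.
  have := degR vb; rewrite negbK (deg_setD1 v ub) /deg -/X; case: (e v u) => /=; lia.
have sX : X \subset R b :\ u by apply/subsetP => x; rewrite inE => /andP[].
have cb : #|R b| = #|R b :\ u|.+1 by rewrite (cardsD1 u (R b)) ub.
have cY : #|Y| < #|R (~~ b)|.
  rewrite (cardsD1 v (R (~~ b))) vb ltnS; apply/subset_leq_card/subsetP => y.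
  by rewrite inE => /andP[].
have cX : #|X| < #|R b| by rewrite cb ltnS subset_leq_card.
have rowX x : x \in X -> deg x (R (~~ b)) + #|Y| <= #|R (~~ b)|.
  move=> xX; have sY : Y \subset R (~~ b).
    by apply/subsetP => y; rewrite !inE => /andP[/andP[_ ->]].
  have := cardsID Y (R (~~ b)); rewrite (setIidPr sY) => <-; rewrite addnC leq_add2l.
  apply/subset_leq_card/subsetP => y; rewrite inE => /andP[yb exy].
  rewrite in_setD yb andbT.
  by apply: contraTN exy => yY; apply: (XY0 x y xX).
(* Such a row misses at least [v]. *)
have rowO x : x \in R b :\ u :\: X -> deg x (R (~~ b)) < #|R (~~ b)|.
  rewrite !inE negb_and => /andP[xX /andP[xu xb]]; rewrite xu xb /= in xX.
  rewrite (deg_setD1 x vb) sym_e (negPf xX) (cardsD1 v (R (~~ b))) vb.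
  exact: deg_le_card.
have row_u : deg u (R (~~ b)) <= #|Y|.+1.
  by rewrite (deg_setD1 u vb) /deg -/Y; case: (e u v).
have arcsX : arcs X (R (~~ b)) <= #|X| * (#|R (~~ b)| - #|Y|).
  by apply: arcs_le => x /rowX; lia.
have arcsO : arcs (R b :\ u :\: X) (R (~~ b)) <= #|R b :\ u :\: X| * #|R (~~ b)|.-1.
  by apply: arcs_le => x /rowO; lia.
have cO : #|R b :\ u :\: X| + #|X| = #|R b :\ u|.
  by rewrite -(cardsID X (R b :\ u)) (setIidPr sX) addnC.
have := crude_budget b.
have -> : arcs (R b) (R (~~ b)) = deg u (R (~~ b)) + arcs X (R (~~ b)) +
    arcs (R b :\ u :\: X) (R (~~ b)).
  rewrite /arcs (big_setD1 u) //= (big_setID X) /= (setIidPr sX); lia.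
apply: (link3_arith (a := #|R b|) (b := #|R (~~ b)|) r_gt2 n_large
  sqr_le_F le_r card_S_lt (card_sides b)).
by apply: (missing_arith cb cO _ _ _ row_u arcsX arcsO); lia.
Qed.

Lemma disjoint_deg b u v : (forall y, y \in R b -> e u y -> ~~ e v y) ->
  deg u (R b) + deg v (R b) <= #|R b|.
Proof.
move=> dis; rewrite -(cardsID [set y | e u y] (R b)); apply: leq_add.
  by apply/subset_leq_card/subsetP => y; rewrite !inE.
apply/subset_leq_card/subsetP => y; rewrite !inE => /andP[yb evy]; rewrite yb andbT.
by apply: contraTN evy; apply: dis.
Qed.

Lemma sum_two b u v (f : T -> nat) : u \in R b -> v \in R b -> u != v ->
  \sum_(x in R b) f x = f u + f v + \sum_(x in R b :\ u :\ v) f x.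
Proof.
move=> ub vb neq_uv; rewrite (big_setD1 u) //= (big_setD1 v) /= ?addnA //.
by rewrite !inE eq_sym neq_uv.
Qed.

Lemma card_two b u v : u \in R b -> v \in R b -> u != v ->
  #|R b| = #|R b :\ u :\ v| + 2.
Proof.
move=> ub vb neq_uv; rewrite (cardsD1 u (R b)) ub (cardsD1 v (R b :\ u)).
by rewrite !inE eq_sym neq_uv vb; lia.
Qed.

(** Without a common neighbour the rows of [u] and [v] together hold at most one full row. *)
Lemma link2 b u v : #|S|.+1 = r -> u \in R b -> v \in R b -> u != v ->
  exists y, [/\ y \in R (~~ b), e u y & e v y].
Proof.
move=> cardS ub vb neq_uv.
have [/exists_inP[y yb /andP[euy evy]]|nocommon] :=
    boolP [exists y in R (~~ b), e u y && e v y]; first by exists y.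
exfalso; have dis y : y \in R (~~ b) -> e u y -> ~~ e v y.
  move=> yb euy; apply: contra nocommon => evy; apply/exists_inP; exists y => //.
  by rewrite euy.
have := crude_budget b.
apply: (link2_arith (a := #|R b|) (b := #|R (~~ b)|) r_gt2 n_large
  sqr_le_F cardS (card_sides b)).
have := disjoint_deg dis; have := card_two ub vb neq_uv.
have := @arcs_le _ e (R b :\ u :\ v) _ _ (fun x _ => deg_le_card e x (R (~~ b))).
rewrite {2}/arcs (sum_two _ ub vb neq_uv) => + -> ; rewrite -/(arcs _ _); lia.
Qed.

(** * Closing paths through [S] *)

Lemma close_cycle u v p q : path e u (rcons p v) -> path e v (rcons q u) ->
  uniq p -> {subset p <= S} -> uniq (v :: rcons q u) -> v \in U -> u \in U ->
  {subset q <= U} -> size p + size q + 1 <> 2 * k.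
Proof.
move=> pth_p pth_q uq_p sub_p uq_q vU uU sub_q sz.
have notS x : x \in U -> x \notin p by apply: contraL => /sub_p; rewrite inE.
have subU : {subset v :: rcons q u <= U}.
  by move=> x; rewrite inE mem_rcons inE => /or3P[/eqP->|/eqP->|/sub_q].
apply: (noC (c := p ++ v :: rcons q u)); last first.
  by rewrite size_cat /= size_rcons; lia.
have uq_c : uniq (p ++ v :: rcons q u).
  by rewrite cat_uniq uq_p uq_q andbT; apply/hasPn => x /subU/notS.
(* Rotated to start at [u], the cycle runs along [p] to [v] and back along [q]. *)
rewrite /ucycle uq_c andbT -(rot_cycle (size (p ++ v :: q))).
rewrite -rcons_cons -rcons_cat -cats1 rot_size_cat /=.
by rewrite rcons_cat -cat_rcons cat_path pth_p last_rcons.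
Qed.

(* Segments of odd cycles: closing [p] to an odd cycle of length 2k+1 inside [U]
   requires a path of length [2 * k - size p]. *)
Definition wrong u v p := [/\ [/\ u \in U, v \in U & u != v],
  path e u (rcons p v), uniq p, {subset p <= S} & odd (size p) = chi u (+) chi v].

Lemma wrong_sym u v p : wrong u v p -> wrong v u (rev p).
Proof.
case=> [[uU vU neq_uv] pth_p uq_p sub_p odd_p]; split.
- by rewrite eq_sym.
- have := rev_path e u (rcons p v); rewrite last_rcons belast_rcons rev_cons => ->.
  by rewrite (eq_path (e' := e)) // => x y; rewrite sym_e.
- by rewrite rev_uniq.
- by move=> x; rewrite mem_rev; apply: sub_p.
- by rewrite size_rev odd_p addbC.
Qed.

Lemma wrong_size_le u v p : wrong u v p -> size p <= #|S|.
Proof.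
case=> _ _ uq_p sub_p _; rewrite -(card_uniqP uq_p); apply/subset_leq_card.
by apply/subsetP => x /sub_p.
Qed.

(** The missing length [2 * k - size p] has the parity of the bipartition: [link3] supplies the
    value 3 and [pathR] all values from 4 on. *)
Lemma wrong_size_ge u v p : wrong u v p -> 2 * k - 2 <= size p.
Proof.
move=> wr; have := wrong_size_le wr; case: wr => [[uU vU neq_uv] pth_p uq_p sub_p odd_p].
move=> le_S; rewrite leqNgt; apply/negP => lt_p.
have [eq3|neq3] := eqVneq (size p) (2 * k - 3).
  have neq_chi : chi u = ~~ chi v.
    have : odd (size p) by rewrite eq3; clear -k_gt1; lia.
    by rewrite odd_p; case: (chi u) (chi v) => -[].
  have [||x [y [[xb yb neq_vx neq_uy] [evy eyx exu]]]] :=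
      link3 (b := chi v) (u := v) (v := u) _ (mem_side vU).
  - by clear -eq3 le_S r_le2k; lia.
  - by rewrite -neq_chi mem_side.
  apply: (close_cycle pth_p (q := [:: y; x])) => //=.
  - by rewrite evy eyx exu.
  - rewrite !inE !negb_or neq_vx (eq_sym v u) neq_uv (eq_sym y u) neq_uy.
    have -> : v != y by apply: contraTneq evy => ->; rewrite irr_e.
    have -> : y != x by apply: contraTneq eyx => ->; rewrite irr_e.
    have -> : x != u by apply: contraTneq exu => ->; rewrite irr_e.
    by [].
  - by move=> z; rewrite !inE => /orP[]/eqP->; [move: yb|move: xb] => /mem_U; rewrite inE.
  - by rewrite eq3 /=; clear -k_gt1; lia.
have [|||q [pth_q uq_q sub_q sz_q]] := @pathR (2 * k - size p) (chi v) v u (mem_side vU).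
- rewrite oddB ?oddM /=; last by clear -lt_p; lia.
  by rewrite odd_p addbC addbK mem_side.
- by rewrite eq_sym.
- by clear -lt_p neq3 k_gt1; lia.
apply: (close_cycle pth_p pth_q uq_p sub_p uq_q vU uU sub_q).
by clear -sz_q lt_p; lia.
Qed.

Lemma wrong_suffix u v w x p1 p2 : wrong u v (p1 ++ x :: p2) ->
  w \in U -> w != v -> e w x -> odd (size p2).+1 = chi w (+) chi v ->
  wrong w v (x :: p2).
Proof.
case=> [[_ vU _]] pth_p uq_p sub_p _ wU neq_wv ewx odd_p2; split=> //.
- by move: pth_p; rewrite /= ewx rcons_cat cat_path => /and3P[].
- by move: uq_p; rewrite cat_uniq => /and3P[].
- by move=> y y_p; apply: sub_p; rewrite mem_cat y_p orbT.
Qed.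

(** As [p] exhausts [S], it passes through [x]. By parity exactly one of the two parts of [p] cut at
    [x] forms a wrong path with [w], and minimality makes that part all of [p]. *)
Lemma wrong_attach u v p w x : 1 < #|S| -> size p = #|S| -> wrong u v p ->
  (forall u' v' p', wrong u' v' p' -> #|S| <= size p') ->
  w \in U -> w != u -> w != v -> x \in S -> e w x ->
  [/\ chi w = chi u, wrong w v p & x = head u p] \/
  [/\ chi w = chi v, wrong u w p & x = last u p].
Proof.
move=> S_gt1 sz_p wr minS wU neq_wu neq_wv xS ewx.
have x_p : x \in p.
  have [_ _ uq_p sub_p _] := wr.
  have sub_pS : {subset p <= enum S} by move=> y /sub_p; rewrite mem_enum.
  have [|_ ->] := uniq_min_size uq_p sub_pS; last by rewrite mem_enum.
  by rewrite sz_p cardE.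
have odd_p : odd (size p) = chi u (+) chi v by case: wr.
case/splitPr: x_p => p1 p2 in wr sz_p odd_p *.
have wr1 := wrong_suffix wr wU neq_wv ewx.
have := wrong_sym wr; rewrite rev_cat rev_cons cat_rcons => /wrong_suffix.
move=> /(_ w wU neq_wu ewx); rewrite size_rev => wr2.
rewrite size_cat /= addnS /= in sz_p odd_p.
rewrite oddD in odd_p.
have [odd_p1|odd_p1] := eqVneq (odd (size p1).+1) (chi w (+) chi u).
  have wr_wu := wr2 odd_p1; have := minS _ _ _ wr_wu; rewrite -sz_p /= size_rev => le_p2.
  have p2_nil : p2 = [::].
    by move: le_p2; rewrite ltnS -[leqRHS]addn0 leq_add2l leqn0 size_eq0 => /eqP.
  subst p2; right; split; last by rewrite last_cat.
    by move: odd_p odd_p1 => /=; case: odd; case: chi; case: chi; case: chi.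
  by have := wrong_sym wr_wu; rewrite rev_cons revK -cats1.
have odd_p2 : odd (size p2).+1 = chi w (+) chi v.
  by move: odd_p odd_p1 => /=; case: odd; case: odd; case: chi; case: chi; case: chi.
have wr_wv := wr1 odd_p2; have := minS _ _ _ wr_wv; rewrite -sz_p /= => le_p1.
have p1_nil : p1 = [::].
  by move: le_p1; rewrite ltnS -[leqRHS]add0n leq_add2r leqn0 size_eq0 => /eqP.
subst p1; left; split=> //.
by move: odd_p odd_p2 => /=; case: odd; case: chi; case: chi; case: chi.
Qed.

(* The paths of the next two lemmas run through all of [S]; then an outside
   neighbour [w] of [S] distinct from [u] and [v] attaches only to an end of the path
   and is, like the endpoint it replaces, the start of another such path. *)
Lemma no_wrong_even u v p : size p = 2 * k - 2 -> ~ wrong u v p.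
Proof.
move=> sz_p wr; have le_pS := wrong_size_le wr; have ltS := card_S_lt.
(* A common neighbour in [U] would supply the missing length 2. *)
have nocommon u' v' p' y : wrong u' v' p' -> size p' = 2 * k - 2 -> y \in U ->
    e u' y -> ~~ e v' y.
  move=> [[u'U v'U neq_uv'] pth_p' uq_p' sub_p' _] sz_p' yU euy; apply/negP => evy.
  apply: (close_cycle pth_p' (q := [:: y])) => //=.
  - by rewrite evy sym_e euy.
  - rewrite !inE negb_or (eq_sym v' u') neq_uv' !andbT; apply/andP; split.
      by apply: contraTneq evy => ->; rewrite irr_e.
    by apply: contraTneq euy => ->; rewrite irr_e.
  - by move=> z; rewrite inE => /eqP->.
  - by qlia.
have [[uU vU neq_uv] _ _ _ _] := wr.
have chi_uv : chi u = chi v.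
  have [_ _ _ _ odd_p] := wr; have : ~~ odd (size p) by rewrite sz_p; clear -k_gt1; lia.
  by rewrite odd_p; case: (chi u); case: (chi v).
pose b := chi u.
have ub : u \in R b by apply: mem_side.
have vb : v \in R b by rewrite /b chi_uv; apply: mem_side.
have [S_eq|S_neq] := eqVneq #|S|.+1 r.
  have [y [yb euy evy]] := link2 S_eq ub vb neq_uv.
  by move: (nocommon _ _ _ y wr sz_p (mem_U yb) euy); rewrite evy.
(* The remaining case has [2 * k - 2 <= #|S| <= r - 2 <= 2 * k - 2], so all are equal. *)
have szS : size p = #|S| by qlia.
have minS u' v' p' : wrong u' v' p' -> #|S| <= size p'.
  by move/wrong_size_ge; qlia.
have S_gt1 : 1 < #|S| by qlia.
have attach w x := wrong_attach (w := w) (x := x) S_gt1 szS wr minS.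
have no_other w : w \in R (~~ b) -> deg w S = 0.
  move=> wb; apply: deg_eq0 => x xS; apply/negP => ewx.
  have neq_w z : z \in R b -> w != z.
    by move=> zb; apply: contraTneq wb => ->; apply: disjR.
  have chi_w := chiE wb.
  have [[]|[]] := attach w x (mem_U wb) (neq_w _ ub) (neq_w _ vb) xS ewx.
    by rewrite chi_w -/b; case: (b).
  by rewrite chi_w -chi_uv -/b; case: (b).
(* A vertex attached to [S] gains at most the two ends of [p], but shares no neighbour with [u] or
   with [v] and so loses more than [4 * r] possible neighbours. *)
have row w : w \in R b :\ u :\ v -> deg w (R (~~ b)) + deg w S <= #|R (~~ b)|.
  rewrite !inE => /and3P[neq_wv neq_wu wb].
  have [/eqP->|] := boolP (deg w S == 0); first by rewrite addn0 deg_le_card.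
  rewrite -lt0n => /deg_gt0P[x xS ewx].
  have deg2 : deg w S <= 2.
    apply: leq_trans (_ : #|[set head u p; last u p]| <= _).
      2: by rewrite cards2; case: eqP.
    apply/subset_leq_card/subsetP => z; rewrite inE => /andP[zS ewz]; rewrite !inE.
    case: (attach w z (mem_U wb) neq_wu neq_wv zS ewz) => -[_ _ ->];
      by rewrite eqxx ?orbT.
  have [z [zb dis]] : exists z, z \in R b /\
      forall y, y \in R (~~ b) -> e w y -> ~~ e z y.
    have [[_ wr' _]|[_ wr' _]] := attach w x (mem_U wb) neq_wu neq_wv xS ewx.
      by exists v; split=> // y yb; apply: (nocommon _ _ _ _ wr' sz_p (mem_U yb)).
    exists u; split=> // y yb; apply: contraTN => euy.
    exact: (nocommon _ _ _ _ wr' sz_p (mem_U yb)).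
  have := disjoint_deg dis; have := degR zb; clear -deg2 r_gt2; lia.
have disuv y : y \in R (~~ b) -> e u y -> ~~ e v y.
  by move=> yb; apply: (nocommon _ _ _ _ wr sz_p (mem_U yb)).
have degSu := deg_le_card e u S; have degSv := deg_le_card e v S.
have := budget b.
rewrite [U](U_setE b) arcs_setUl ?disjoint_sides //.
rewrite (_ : arcs (R (~~ b)) S = 0); last first.
  by apply: big1 => w wb; apply: no_other.
have rows : arcs (R b) (R (~~ b)) + arcs (R b) S <=
    #|R (~~ b)| + 2 * #|S| + #|R b :\ u :\ v| * #|R (~~ b)|.
  rewrite /arcs -big_split /= (sum_two _ ub vb neq_uv); apply: leq_add.
    by have := disjoint_deg disuv; qlia.
  by rewrite -sum_nat_const; apply: leq_sum.
(* The disjoint rows of [u] and [v] count as one row, which makes the sum of the factors exactly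
   [n - r + 1]. *)
have := @mul_le_F (#|R b :\ u :\ v| + 1) #|R (~~ b)|.
have := card_two ub vb neq_uv; have := card_sides b => cardE cardRb.
move=> /(_ ltac:(qlia)).
have rE : r = #|S| + 2 by qlia.
move=> leF leB; apply: (even_arith _ rE leF leB); last by rewrite addn0.
exact: ltnW.
Qed.

Lemma no_wrong_odd u v p : size p = 2 * k - 1 -> ~ wrong u v p.
Proof.
move=> sz_p wr; have le_pS := wrong_size_le wr; have ltS := card_S_lt.
have szS : size p = #|S| by qlia.
have minS u' v' p' : wrong u' v' p' -> #|S| <= size p'.
  move=> wr'; have := wrong_size_ge wr'.
  have [/no_wrong_even/(_ wr') //|] := eqVneq (size p') (2 * k - 2); qlia.
(* The missing length is 1, so an edge between the endpoints would close the cycle. *)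
have nonadj u' v' : wrong u' v' p -> ~~ e u' v'.
  move=> [[u'U v'U neq_uv'] pth_p uq_p sub_p _]; apply/negP => euv.
  apply: (close_cycle pth_p (q := [::])) => //=.
  - by rewrite sym_e euv.
  - by rewrite inE eq_sym neq_uv'.
  - by qlia.
have [[uU vU neq_uv] _ _ _ _] := wr.
have chi_uv : chi v = ~~ chi u.
  have [_ _ _ _ odd_p] := wr; have : odd (size p) by rewrite sz_p; clear -k_gt1; lia.
  by rewrite odd_p; case: (chi u); case: (chi v).
pose b := chi u.
have ub : u \in R b by apply: mem_side.
have vb : v \in R (~~ b) by rewrite /b -chi_uv; apply: mem_side.
have S_gt1 : 1 < #|S| by qlia.
have attach w x := wrong_attach (w := w) (x := x) S_gt1 szS wr minS.
have neq_sides x y b' : x \in R b' -> y \in R (~~ b') -> x != y.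
  by move=> xc; apply: contraTneq => <-; apply: disjR.
have row_u w : w \in R b :\ u -> deg w (R (~~ b)) + deg w S <= #|R (~~ b)|.
  rewrite !inE => /andP[neq_wu wb].
  have [/eqP->|] := boolP (deg w S == 0); first by rewrite addn0 deg_le_card.
  rewrite -lt0n => /deg_gt0P[x xS ewx].
  have attach_w z : z \in S -> e w z -> wrong w v p /\ z = head u p.
    move=> zS ewz; have [[_ ? ->]|[]] // :=
      attach w z (mem_U wb) neq_wu (neq_sides _ _ _ wb vb) zS ewz.
    by rewrite (chiE wb) chi_uv -/b; case: (b).
  have deg1 : deg w S <= 1.
    rewrite -(cards1 (head u p)); apply/subset_leq_card/subsetP => z.
    by rewrite inE => /andP[zS ewz]; rewrite inE; have [_ ->] := attach_w z zS ewz.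
  have [/nonadj nwv _] := attach_w x xS ewx.
  rewrite (deg_setD1 w vb) (negPf nwv) (cardsD1 v (R (~~ b))) vb.
  by rewrite [X in _ <= X]addnC; apply: leq_add; rewrite ?deg_le_card.
have row_v w : w \in R (~~ b) :\ v -> e u w + deg w S <= 1.
  rewrite !inE => /andP[neq_wv wb].
  have [/eqP->|] := boolP (deg w S == 0); first by case: (e u w).
  rewrite -lt0n => /deg_gt0P[x xS ewx].
  have neq_wu : w != u by rewrite eq_sym (neq_sides _ _ _ ub wb).
  have attach_w z : z \in S -> e w z -> wrong u w p /\ z = last u p.
    move=> zS ewz; have [[]|[_ ? ->]] // := attach w z (mem_U wb) neq_wu neq_wv zS ewz.
    by rewrite (chiE wb) -/b; case: (b).
  have deg1 : deg w S <= 1.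
    rewrite -(cards1 (last u p)); apply/subset_leq_card/subsetP => z.
    by rewrite inE => /andP[zS ewz]; rewrite inE; have [_ ->] := attach_w z zS ewz.
  by have [/nonadj/negPf-> _] := attach_w x xS ewx.
(* A common neighbour in [S] would be a wrong path with one inner vertex, shorter than the
   minimum. *)
have degSuv : deg u S + deg v S <= #|S|.
  rewrite !degE -big_split /= -sum1_card; apply: leq_sum => x xS.
  case eux: (e u x) => //=; last by case: (e v x).
  case evx: (e v x) => //; have : #|S| <= size [:: x]; last by rewrite /= leqNgt S_gt1.
  apply: (minS u v); split=> //=.
  - by rewrite eux sym_e evx.
  - by move=> z; rewrite inE => /eqP->.
  - by rewrite chi_uv; case: (chi u).
have := budget b.
rewrite [U](U_setE b) arcs_setUl ?disjoint_sides //.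
(* The edges from [u] to [R (~~ b)] are charged to their other ends: by [row_v] each vertex there
   except [v] pays at most 1 for [u] and [S] together, and [v] is not adjacent to [u]. *)
have rows : arcs (R b) (R (~~ b)) + arcs (R b) S + arcs (R (~~ b)) S <=
    #|R b :\ u| * #|R (~~ b)| + #|R (~~ b) :\ v| + #|S|.
  have -> : arcs (R (~~ b)) S = deg v S + arcs (R (~~ b) :\ v) S.
    by rewrite /arcs (big_setD1 v).
  have -> : arcs (R b) (R (~~ b)) + arcs (R b) S =
      deg u (R (~~ b) :\ v) + deg u S +
      \sum_(w in R b :\ u) (deg w (R (~~ b)) + deg w S).
    rewrite /arcs -big_split /= (big_setD1 u) //= (deg_setD1 u vb).
    by rewrite (negPf (nonadj _ _ wr)).
  have h1 : \sum_(w in R b :\ u) (deg w (R (~~ b)) + deg w S) <=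
      #|R b :\ u| * #|R (~~ b)| by rewrite -sum_nat_const; apply: leq_sum.
  have h2 : deg u (R (~~ b) :\ v) + arcs (R (~~ b) :\ v) S <= #|R (~~ b) :\ v|.
    by rewrite degE /arcs -big_split /= -sum1_card; apply: leq_sum.
  lia.
have := @mul_le_F #|R b| #|R (~~ b)|.
have := card_sides b => cardE; have := cardsD1 u (R b); have := cardsD1 v (R (~~ b)).
have rE : r = #|S| + 1 by qlia.
rewrite ub vb /= => cv cu /(_ ltac:(qlia)) leF; rewrite addnA => leB.
exact: (odd_arith (ltnW S_gt1) rE cu cv leF leB rows).
Qed.

Lemma no_wrong u v p : ~ wrong u v p.
Proof.
move=> wr; have := wrong_size_ge wr; have := wrong_size_le wr; have := card_S_lt.
have [/no_wrong_even/(_ wr)//|] := eqVneq (size p) (2 * k - 2).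
have [/no_wrong_odd/(_ wr)//|] := eqVneq (size p) (2 * k - 1); qlia.
Qed.

(** Induction along the walk, where [q] collects the vertices of [S] met since the last vertex [x]
    of [U]. On each return to [U] the segment is not wrong, so it respects the colouring [chi]. *)
Lemma walk_parity p q x : path e x (q ++ p) -> uniq (x :: q ++ p) -> x \in U ->
  {subset q <= S} -> last x (q ++ p) \in U ->
  odd (size (q ++ p)) = chi x (+) chi (last x (q ++ p)).
Proof.
elim: p q x => [|z p IHp] q x.
  rewrite cats0; case/lastP: q => [|q y]; first by rewrite addbb.
  move=> _ _ _ sub_q; rewrite last_rcons => yU.
  by have := sub_q y; rewrite mem_rcons mem_head inE yU => /(_ isT).
have [zU|zS] := boolP (z \in U); last first.
  rewrite -cat_rcons => pth uq xU sub_q; apply: IHp => // y.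
  by rewrite mem_rcons inE => /predU1P[->|/sub_q//]; rewrite inE.
move=> pth uq xU sub_q lastU.
have odd_p : odd (size p) = chi z (+) chi (last z p).
  apply: (IHp [::]) => //.
  - by move: pth; rewrite cat_path /= => /and3P[].
  - by move: uq; rewrite /= cat_uniq => /and4P[].
  - by move: lastU; rewrite last_cat.
have odd_q : odd (size q) = ~~ (chi x (+) chi z).
  have [odd_q|] := eqVneq (odd (size q)) (chi x (+) chi z); last first.
    by case: odd; case: chi; case: chi.
  case: (@no_wrong x z q); split=> //.
  - by split=> //; apply: contraTneq uq => ->; rewrite /= mem_cat mem_head orbT.
  - by move: pth; rewrite -cat_rcons cat_path => /andP[].
  - by move: uq; rewrite /= cat_uniq => /and3P[].
rewrite size_cat last_cat /= addnS /= oddD odd_p odd_q.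
by case: chi; case: chi; case: chi.
Qed.

(** Two vertices of [U] cut the cycle into two paths with distinct ends, whose lengths have the same
    parity by [walk_parity], so the cycle is even. *)
Lemma no_long_odd_cycle c : ucycle e c -> odd (size c) -> size c <= r.
Proof.
move=> /andP[cyc_c uq_c] odd_c; rewrite leqNgt; apply/negP => gt_r.
have notS s : uniq s -> #|S| < size s -> exists2 x, x \in s & x \in U.
  move=> uq_s lt_s; suff /subsetPn[x xs] : ~~ ([set x in s] \subset S).
    by rewrite inE negbK; exists x; rewrite // inE in xs.
  apply: contraL lt_s => /subset_leq_card; rewrite cardsE (card_uniqP uq_s).
  by rewrite -leqNgt.
have [|x xc xU] := notS c uq_c; first exact: ltn_trans card_S_lt gt_r.
case: (rot_to xc) => i c' def_c.
have uq_c' : uniq (x :: c') by rewrite -def_c rot_uniq.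
have sz_c : size c = (size c').+1 by rewrite -(size_rot i c) def_c.
have [||y yc' yU] := notS c'; first by case/andP: uq_c'.
  by rewrite -ltnS -sz_c; apply: leq_ltn_trans card_S_lt gt_r.
have := cyc_c; rewrite -(rot_cycle i) def_c /=.
case/splitPr: yc' => p1 p2 in uq_c' sz_c def_c *.
rewrite rcons_cat -cat_rcons cat_path last_rcons => /andP[pth1 pth2].
have odd1 : odd (size p1).+1 = chi x (+) chi y.
  have := @walk_parity (rcons p1 y) [::] x; rewrite last_rcons size_rcons; apply=> //.
  by move: uq_c'; rewrite -cat_rcons /= mem_cat negb_or cat_uniq => /and3P[/andP[-> _]].
have odd2 : odd (size p2).+1 = chi y (+) chi x.
  have := @walk_parity (rcons p2 x) [::] y; rewrite last_rcons size_rcons; apply=> //.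
  move: uq_c'; rewrite -cat_cons cat_uniq => /and3P[_ /hasPn/(_ x)].
  rewrite mem_head /= rcons_uniq inE mem_rcons inE (eq_sym y).
  move=> h /andP[y_p2 ->]; rewrite negb_or y_p2 !andbT /= -negb_or -in_cons.
  by apply: contraTN isT => xp; move: (h xp).
move: odd_c; rewrite sz_c size_cat /= addnS /= negbK oddD.
by move: odd1 odd2 => /=; case: odd; case: odd; case: chi; case: chi.
Qed.

End WrongPaths.

(** * Assembly: from the edge bound to the odd cycles *)

Lemma odd_cycle_le (T : finType) (e : rel T) (k r : nat) :
  symmetric e -> irreflexive e -> 1 < k -> 2 < r -> r <= 2 * k ->
  2 * (r + 2) * (r + 1) * (r + 2 * k) <= #|T| ->
  (#|T| - r + 1) ^ 2 %/ 4 + 'C(r, 2) <= num_edges e ->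
  (forall c, ucycle e c -> size c <> 2 * k + 1) ->
  forall c, ucycle e c -> odd (size c) -> size c <= r.
Proof.
move=> sym_e irr_e k_gt1 r_gt2 r_le2k n_large many_edges noC.
have many_arcs : 2 * ((#|T| - r + 1) ^ 2 %/ 4) + r * (r - 1) <= arcs e setT setT.
  apply: leq_trans (num_edges_arcs sym_e irr_e).
  have := mul_bin_diag r 1; rewrite bin1 -subn1 => ->.
  by rewrite -mulnDr leq_mul2l.
have [C [m [linked disjC le2k_m le4r_m le_n]]] :=
  core_exists sym_e irr_e (erefl _) k_gt1 r_gt2 r_le2k n_large noC many_arcs.
have [_ n_large2] := large_order_bounds r_gt2 r_le2k n_large.
have tau_gt2 : 2 < 4 * r + 1 by lia.
(* This threshold gives hull vertices the more than [4 * r] neighbours on the other side that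
   [link3] needs. *)
pose R := hull e C (4 * r + 1).
pose core := C true :|: C false; pose U := R true :|: R false.
have sub_core : core \subset U := core_sub_hull linked le4r_m.
have card_outer : #|U :\: core| + #|~: U| <= 7 * (r - 1).
  have := cardsC U; have := cardsID core U; rewrite (setIidPr sub_core).
  by move: le_n; rewrite -/core; lia.
apply: (@no_long_odd_cycle _ _ sym_e irr_e R k r #|T| _ k_gt1 r_gt2 r_le2k (erefl _)
  n_large2 (quarter_sqr_bounds _) _ noC _ _ _ _ _ _ many_arcs).
- by move=> i j <-; apply: mul_le_quarter_sqr.
- exact: (hull_disjoint sym_e irr_e linked disjC k_gt1 le2k_m noC tau_gt2).
- exact: (hull_indep sym_e irr_e linked k_gt1 le2k_m noC tau_gt2 le4r_m).
- move=> L b u v ub vb neq_uv le_L.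
  have [p [pth_p uq_p sub_p sz_p]] :=
    hull_path sym_e irr_e linked k_gt1 le2k_m tau_gt2 le4r_m ub vb neq_uv le_L.
  by exists p; split=> // x /sub_p; apply: (subsetP sub_core).
- move=> b u; rewrite inE addn1 => lt_u; apply: leq_trans lt_u _.
  by apply: deg_subset; apply/subsetP => x; apply: (mem_hull linked le4r_m).
- move=> x; rewrite in_setC in_setU negb_or => /andP[xt xf].
  have := deg_core_outside sym_e irr_e linked disjC k_gt1 le2k_m noC xt xf.
  rewrite -/core -/U => deg_core.
  have -> : deg e x U = deg e x core + deg e x (U :\: core).
    rewrite -deg_setU; last by apply/pred0P => y; rewrite /= in_setD; case: (y \in core).
    by rewrite -{1}(setID U core) (setIidPr sub_core).
  have := deg_le_card e x (U :\: core); lia.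
- exact: leq_trans (leq_addl _ _) card_outer.
Qed.

Theorem theorem1p6 (n k r : nat) (n_gt0 : 0 < n) (k_gt0 : 0 < k) (r_gt0 : 0 < r)
    (k_ge2 : 2 <= k) (r_ge3 : 3 <= r) (r_le2k : r <= 2 * k)
    (n_large : 2 * (r + 2) * (r + 1) * (r + 2 * k) <= n)
    (T : finType) (e : rel T) (simple_e : simple_graph e) (card_T : #|T| = n)
    (many_edges : (n - r + 1) ^ 2 %/ 4 + 'C(r, 2) <= num_edges e) :
  contains_cycle e (2 * k + 1) \/
  ~ (exists l : nat, [/\ odd l, r < l & contains_cycle e l]).
Proof.
have [sym_e irr_e] := simple_e; subst n.
(* Cycles of a fixed length are tuples over a finite type, so their existence is decidable. *)
have [/existsP[c cyc_c]|noC] := boolP [exists c : (2 * k + 1).-tuple T, ucycleb e c].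
  by left; split; [lia | exists c; rewrite size_tuple].
right=> -[l [odd_l lt_rl [_ [c [cyc_c sz_c]]]]]; subst l.
suff noC' c' : ucycle e c' -> size c' <> 2 * k + 1.
  have := odd_cycle_le sym_e irr_e k_ge2 r_ge3 r_le2k n_large many_edges noC' cyc_c odd_l.
  by rewrite leqNgt lt_rl.
move=> cyc_c' sz_c'; apply: (negP noC); apply/existsP.
by exists (tcast sz_c' (in_tuple c')); rewrite val_tcast.
Qed.
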